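(* Let $\kappa$ be an infinite cardinal and $M$ a nonempty subset of $\beta\kappa$. Let $X$ be a $T_1$-space and $Y$ be a Hausdorff $M$-compact space. Assume that either the space $Y$ is $\overline{\kappa}$-Urysohn or the space $X$ contains no long $\kappa$-butterflies. Then for any continuous function $f:X\to Y$ there exists a unique $[M]$-continuous function $\bar f:\mathsf W_MX\to Y$ such that $f=\bar f{\restriction}X$ (where $X$ is identified with its image $j_X(X)\subset \mathsf W_MX$, i.e. $f=\bar f\circ j_X$).
   Context: $\kappa$ carries the discrete topology; $\beta\kappa$ is the compact Hausdorff space of all ultrafilters on $\kappa$ (points of $\kappa$ identified with principal ultrafilters), with base of sets $\{p:R\in p\}$, $R\subset\kappa$. For $p\in\beta\kappa$ and a function $x:\kappa\to Z$ into a topological space, $\lim_p x$ is the set of points $\bar x\in Z$ such that $x^{-1}(U)\in p$ for every neighborhood $U$ of $\bar x$. For a nonempty $N\subset\beta\kappa$: a space $Z$ is $N$-compact if $\lim_p x\ne\emptyset$ for all $p\in N$, $x:\kappa\to Z$; a set $A\subset Z$ is $N$-closed in $Z$ if $\lim_p x\subset A$ for all $x:\kappa\to A$ and $p\in N$; the $N$-closure of $A$ in $Z$ is the smallest $N$-closed subset of $Z$ containing $A$; a function $f:Z\to Y$ is $N$-continuous if $f(\lim_p z)\subset\lim_p(f\circ z)$ for all $p\in N$, $z\in Z^\kappa$. $[M]$ denotes the $M$-closure of $\kappa$ in $\beta\kappa$. A $T_1$-space is a space in which all finite subsets are closed. A space $Y$ is $\overline{\kappa}$-Urysohn if for any $C\subset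 Y$ with $|C|\le\kappa$ and distinct points $x,y\in Y$ there are disjoint open sets $V,W$ in $Y$ with $x\in V$, $y\in W$ and $\overline{V\cap C}\cap\overline{W\cap C}=\emptyset$. A butterfly in $X$ is a pair $(U,V)$ of disjoint open sets with $\overline U\cap\overline V\ne\emptyset$; it is a long $\kappa$-butterfly if there are subsets $A\subset U$, $B\subset V$ of cardinality $\le\kappa$ such that $\overline A\cap\overline B\neq\emptyset$ and the space $\overline A\cap\overline B$ is not compact. Wallman extension: $\mathsf WX$ is the set of closed ultrafilters on $X$, i.e. families $\mathcal F$ of closed subsets of $X$ such that $\emptyset\notin\mathcal F$; $A\cap B\in\mathcal F$ for all $A,B\in\mathcal F$; and a closed set $F\subset X$ belongs to $\mathcal F$ if $F\cap A\neq\emptyset$ for every $A\in\mathcal F$. Its topology is generated by the base of sets $\langle U\rangle=\{\mathcal F\in\mathsf WX:\exists F\in\mathcal F\ (F\subset U)\}$, $U$ open in $X$. For a $T_1$-space $X$, $j_X:X\to\mathsf WX$ sends $x$ to the family of all closed sets containing $x$; it is a topological embedding. $\mathsf W_MX$ is the $[M]$-closure of $j_X(X)$ in $\mathsf WX$, with the subspace topology. *)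

(* Defs.v *)
From HB Require Import structures.
From mathcomp Require Import all_boot all_order all_algebra.
From mathcomp Require Import all_classical all_reals all_analysis.

Set Implicit Arguments.
Unset Strict Implicit.
Unset Printing Implicit Defensive.

Local Open Scope classical_set_scope.
Local Open Scope card_scope.

(* An infinite cardinal is represented by a type K with that many elements. *)
Record beta (K : Type) := Beta {
  ultra : set_system K;
  ultra_ultrafilter : UltraFilter ultra }.

Section beta_topology.
Context {K : Type}.

HB.instance Definition _ := gen_eqMixin (beta K).
HB.instance Definition _ := gen_choiceMixin (beta K).

Definition beta_base (R : set K) : set (beta K) := [set p | ultra p R].

Lemma beta_base_cover : \bigcup_(R in [set: set K]) beta_base R = [set: beta K].
Proof.
apply/seteqP; split=> // p _; exists setT => //=.
by have ? := ultra_ultrafilter p; exact: filterT.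
Qed.

Lemma beta_base_join (R S : set K) (p : beta K) :
  [set: set K] R -> [set: set K] S -> beta_base R p -> beta_base S p ->
  exists T, [/\ [set: set K] T, beta_base T p &
    beta_base T `<=` beta_base R `&` beta_base S].
Proof.
move=> _ _ pR pS; exists (R `&` S); split=> //.
  by have ? := ultra_ultrafilter p; exact: filterI.
move=> q qRS; have ? := ultra_ultrafilter q.
by split; apply: filterS qRS => k [].
Qed.

HB.instance Definition _ :=
  isBaseTopological.Build (beta K) beta_base_cover beta_base_join.

Definition beta_point (k : K) : beta K := Beta (principal_filter_ultra k).

End beta_topology.

(* The set of all limits: it may be empty, or have several elements. *)
Definition ulim {K : Type} {Z : topologicalType} (p : beta K) (x : K -> Z) :
  set Z := [set z | x @ ultra p --> z].

Section N_notions.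
Context {K : Type} (N : set (beta K)).

Definition N_compact (Z : topologicalType) :=
  forall (p : beta K) (x : K -> Z), N p -> ulim p x !=set0.

Definition N_closed {Z : topologicalType} (A : set Z) :=
  forall (x : K -> Z) (p : beta K),
    (forall k, A (x k)) -> N p -> ulim p x `<=` A.

Definition N_closure {Z : topologicalType} (A : set Z) : set Z :=
  smallest N_closed A.

Lemma N_closure_closed {Z : topologicalType} (A : set Z) :
  N_closed (N_closure A).
Proof.
move=> x p Ax Np z xz B [NB AB]; apply: (NB x p _ Np z xz) => k.
by apply: Ax; split.
Qed.

Definition N_continuous {Z Y : topologicalType} (f : Z -> Y) :=
  forall (p : beta K) (z : K -> Z),
    N p -> f @` ulim p z `<=` ulim p (f \o z).

(* [beta_closure M] is the set usually written [M]. *)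
Definition beta_closure : set (beta K) := N_closure (range beta_point).

End N_notions.

(* [kbar_urysohn K] is "\overline{\kappa}-Urysohn", for \kappa = |K|. *)
Definition kbar_urysohn (K : Type) (Y : topologicalType) :=
  forall (C : set Y) (x y : Y), C #<= [set: K] -> x <> y ->
    exists V W : set Y, [/\ open V, open W, V `&` W = set0, V x & W y] /\
      closure (V `&` C) `&` closure (W `&` C) = set0.

Definition butterfly {X : topologicalType} (U V : set X) :=
  [/\ open U, open V, U `&` V = set0 & closure U `&` closure V !=set0].

Definition long_butterfly (K : Type) {X : topologicalType} (U V : set X) :=
  butterfly U V /\
  exists A B : set X, [/\ A `<=` U, B `<=` V, A #<= [set: K] & B #<= [set: K]] /\
    closure A `&` closure B !=set0 /\ ~ compact (closure A `&` closure B).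

Section wallman.
Context {X : topologicalType}.

Record closed_ultrafilter (F : set (set X)) : Prop := ClosedUltrafilter {
  cultra_closed : F `<=` closed;
  cultra_set0 : ~ F set0;
  cultra_setI : forall A B, F A -> F B -> F (A `&` B);
  cultra_max : forall C, closed C -> (forall A, F A -> C `&` A !=set0) -> F C }.

Record wallman := Wallman {
  cultra : set (set X);
  cultraP : closed_ultrafilter cultra }.

HB.instance Definition _ := gen_eqMixin wallman.
HB.instance Definition _ := gen_choiceMixin wallman.

Definition wallman_base (U : set X) : set wallman :=
  [set F | exists2 A, cultra F A & A `<=` U].

Lemma wallman_base_cover : \bigcup_(U in open) wallman_base U = [set: wallman].
Proof.
apply/seteqP; split=> // F _; exists setT; first exact: openT.
have [[A FA]|F0] := pselect (exists A, cultra F A); first by exists A.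
case: (cultra_set0 (cultraP F)); apply: (cultra_max (cultraP F)).
  exact: closed0.
by move=> A FA; case: F0; exists A.
Qed.

Lemma wallman_base_join (U V : set X) (F : wallman) :
  open U -> open V -> wallman_base U F -> wallman_base V F ->
  exists W, [/\ open W, wallman_base W F &
    wallman_base W `<=` wallman_base U `&` wallman_base V].
Proof.
move=> oU oV [A FA AU] [B FB BV]; exists (U `&` V); split.
- exact: openI.
- exists (A `&` B); first exact: cultra_setI (cultraP F) _ _ FA FB.
  by move=> x [/AU ? /BV].
- by move=> G [C GC CUV]; split; exists C => // x /CUV[].
Qed.

HB.instance Definition _ :=
  isBaseTopological.Build wallman wallman_base_cover wallman_base_join.

Lemma closed_ultrafilter_point (T1 : @accessible_space X) (x : X) :
  closed_ultrafilter [set A | closed A /\ A x].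
Proof.
split.
- by move=> A [].
- by case.
- by move=> A B [cA Ax] [cB Bx]; split; [exact: closedI|].
- move=> C cC CA; split=> //.
  have [|y [Cy yx]] := CA [set x].
    by split=> //; exact: accessible_closed_set1.
  by rewrite -(yx : y = x).
Qed.

(* The map j_X; its values are closed ultrafilters only because X is T_1. *)
Definition wallman_point (T1 : @accessible_space X) (x : X) : wallman :=
  Wallman (closed_ultrafilter_point T1 x).

End wallman.
Arguments wallman : clear implicits.

Section wallmanM.
Context {K : Type} (M : set (beta K)) {X : topologicalType}
  (T1 : @accessible_space X).

(* As a type, this set carries the subspace topology of [wallman X]. *)
Definition wallmanM : set (wallman X) :=
  N_closure (beta_closure M) (range (wallman_point T1)).

Lemma wallmanM_point (x : X) : wallman_point T1 x \in wallmanM.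
Proof. by apply/mem_set; apply: (sub_smallest (@subset_refl _ _)); exists x. Qed.

Definition wallmanM_embed (x : X) : wallmanM :=
  exist _ (wallman_point T1 x) (wallmanM_point x).

End wallmanM.

(* Main.v *)
(* Since K * K injects into K, an iterated [M]-limit of K-sequences of points of
   X is a single [M]-limit of such a sequence. Hence every w in W_M X is a limit
   of j_X o x along some p in [M], and fbar w must be lim_p (f o x), which exists
   because M-compactness of Y passes to [M].

   If w had two values y <> y', coming from x along p and from x' along p', take
   disjoint open V and V' around them. The closures of the parts A of range x
   and A' of range x' that f sends to V and V' both belong to w, hence meet.
   This contradicts the Urysohn property for a suitable choice of V and V'.
   Otherwise the two preimages form a butterfly; as it is not long, the
   intersection of the two closures is compact, so w is a point j_X x0 and
   y = f x0 = y' by continuity of f. *)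
Require Import Defs.
From mathcomp Require Import all_boot all_order all_algebra.
From mathcomp Require Import all_classical all_reals all_analysis.
Set Implicit Arguments.
Unset Strict Implicit.
Unset Printing Implicit Defensive.
Local Open Scope classical_set_scope.
Local Open Scope card_scope.

(** * Comparability of cardinals, and an injection of [K * K] into [K] *)

Lemma card_le_total (T U : Type) (A : set T) (B : set U) :
  A #<= B \/ B #<= A.
Proof.
(* Zorn's lemma applies to graphs of partial injections from [A] to [B]. If a maximal one missed a
   point of [A] and a point of [B], that pair could be added to it. *)
pose P (G : set (T * U)) := G `<=` A `*` B /\
  forall p q, G p -> G q -> (p.1 = q.1 <-> p.2 = q.2).
have [F FP Ftot|G [[GAB Ginj] Gmax]] := @Zorn_bigcup _ P.
  split=> [p [X FX Xp]|p q [X FX Xp] [Z FZ Zq]]; first exact: (FP X FX).1.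
  by have [XZ|ZX] := Ftot _ _ FX FZ;
    [apply: (FP Z FZ).2 => //; exact: XZ|apply: (FP X FX).2 => //; exact: ZX].
have fstG : fst @` G #= G.
  apply: inj_card_eq => p q /set_mem Gp /set_mem Gq e.
  by rewrite [p]surjective_pairing [q]surjective_pairing e (Ginj p q _ _).1.
have sndG : snd @` G #= G.
  apply: inj_card_eq => p q /set_mem Gp /set_mem Gq e.
  by rewrite [p]surjective_pairing [q]surjective_pairing e (Ginj p q _ _).2.
have [AG|/existsNP[a /not_implyP[Aa Ga]]] := pselect (A `<=` fst @` G).
  left; apply: card_le_trans (subset_card_le AG) _.
  rewrite (card_le_eql fstG) -(card_le_eql sndG); apply: subset_card_le.
  by move=> _ [p Gp <-]; exact: (GAB p Gp).2.
have [BG|/existsNP[b /not_implyP[Bb Gb]]] := pselect (B `<=` snd @` G).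
  right; apply: card_le_trans (subset_card_le BG) _.
  rewrite (card_le_eql sndG) -(card_le_eql fstG); apply: subset_card_le.
  by move=> _ [p Gp <-]; exact: (GAB p Gp).1.
exfalso; apply: (Gmax (G `|` [set (a, b)])).
  split; first by move=> p; left.
  move=> /(_ (a, b)) GT; apply: Ga; exists (a, b) => //; apply: GT; by right.
split=> [p [/GAB//|->]|p q [Gp|->] [Gq|->]] //=.
- exact: Ginj.
- by split=> e; [case: Ga|case: Gb]; exists p.
- by split=> e; [case: Ga|case: Gb]; exists q.
Qed.

(* The tags [a] and [b] give two disjoint copies of [S] inside [S], one to hold
   [S] and the other to hold [S']. *)
Lemma pairing_setU_inj (K : Type) (S S' : set K) (g : K -> K -> K) (psi : K -> K)
    (a b : K) :
  (forall u v, S u -> S v -> S (g u v)) ->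
  (forall u v u' v', S u -> S v -> S u' -> S v' ->
     g u v = g u' v' -> u = u' /\ v = v') ->
  S a -> S b -> a <> b ->
  (forall u, S' u -> S (psi u)) -> set_inj S' psi ->
  exists2 h : K -> K, forall u, (S `|` S') u -> S (h u) & set_inj (S `|` S') h.
Proof.
move=> gS ginj Sa Sb ab psiS psiinj.
exists (fun u => if pselect (S u) then g a u else g b (psi u)) => [u|].
  by case: pselect => Su [] // S'u; apply: gS => //; exact: psiS.
move=> u v /set_mem Tu /set_mem Tv.
have S'E w : ~ S w -> (S `|` S') w -> S' w by move=> Sw [].
case: pselect => Su; case: pselect => Sv /ginj[] //.
- by move=> *; apply: psiS; exact: S'E.
- by move=> *; apply: psiS; exact: S'E.
- by move=> /esym.
- by move=> *; apply: psiS; exact: S'E.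
- by move=> *; apply: psiS; exact: S'E.
- by move=> _ /psiinj; apply; apply/mem_set; exact: S'E.
Qed.

Lemma injective_cancel (T U : Type) (g : T -> U) (t0 : T) :
  injective g -> exists e : U -> T, cancel g e.
Proof.
move=> gi; have /choice[e eP] : forall u, exists t, forall s, g s = u -> s = t.
  move=> u; have [[t <-]|nt] := pselect (exists t, g t = u).
    by exists t => s /gi.
  by exists t0 => s su; case: nt; exists s.
by exists e => t; exact/esym/(eP (g t)).
Qed.

(** Take a maximal set [S] with an injective pairing. If the complement of [S] injects into [S],
    then so does [K], and the pairing pulls back to [K]. Otherwise [S] has a disjoint copy in its
    complement, over which the pairing extends, against maximality. *)
Lemma infinite_prod_inj (K : Type) :
  infinite_set [set: K] -> exists g : K * K -> K, injective g.
Proof.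
elim/Ppointed: K => K infK.
  by case: infK; rewrite emptyE; exact: finite_set0.
(* The two distinct points are the tags that [pairing_setU_inj] requires. *)
pose good (t : set K * (K -> K -> K)) :=
  [/\ forall u v, t.1 u -> t.1 v -> t.1 (t.2 u v),
      forall u v u' v', t.1 u -> t.1 v -> t.1 u' -> t.1 v' ->
        t.2 u v = t.2 u' v' -> u = u' /\ v = v' &
      exists a b, [/\ t.1 a, t.1 b & a <> b]].
(* Pairings are total functions compared only on their carriers, so [R] is a preorder but not an
   order. *)
pose R (t s : {t | good t}) := `[< (sval t).1 `<=` (sval s).1 /\
  forall u v, (sval t).1 u -> (sval t).1 v -> (sval t).2 u v = (sval s).2 u v >].
have Rxx t : R t t by apply/asboolP; split.
have [t0 gt0] : exists t, good t.
  (* Zorn's lemma starts from a copy of the natural numbers in [K], paired by [pickle]. *)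
  have /infiniteP/pcard_leP[i] := infK.
  have ii m n : i m = i n -> m = n by apply: inj; rewrite inE.
  have [j ij] := injective_cancel 0%N ii.
  exists (range i, fun u v => i (pickle (j u, j v))); split=> /=.
  - by move=> u v _ _; eexists.
  - move=> _ _ _ _ [m _ <-] [n _ <-] [m' _ <-] [n' _ <-] /ii.
    by rewrite !ij => /(pcan_inj pickleK)[-> ->].
  - by exists (i 0%N), (i 1%N); split; [exists 0%N|exists 1%N|move/ii].
have [||A Atot|[[S g] [/= gS ginj [a [b [Sa Sb ab]]]]] tmax] :=
    @ZL_preorder _ (exist _ t0 gt0) R.
- exact: Rxx.
- move=> q s t /asboolP[qs eqs] /asboolP[st est]; apply/asboolP.
  split=> [u qu|u v qu qv]; first by apply: st; apply: qs.
  by rewrite eqs // est //; apply: qs.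
- have [[t1 At1]|A0] := pselect (A !=set0); last first.
    by exists (exist _ t0 gt0) => s As; case: A0; exists s.
  have RP s t : R s t -> (sval s).1 `<=` (sval t).1 /\ forall u v,
    (sval s).1 u -> (sval s).1 v -> (sval s).2 u v = (sval t).2 u v by move/asboolP.
  have ubound s t : A s -> A t -> exists2 r, A r & R s r /\ R t r.
    move=> As At; have [st|ts] := Atot _ _ As At.
      by exists t.
    by exists s.
  (* The pairing on the union of the chain [A]: members of [A] that contain both points agree on
     their value there. If there is no such member, the value is arbitrary. *)
  have /choice[g gP] : forall w : K * K, exists c, forall t, A t ->
      (sval t).1 w.1 -> (sval t).1 w.2 -> c = (sval t).2 w.1 w.2.
    move=> [u v] /=.
    have [[t [At tu tv]]|nt] :=
        pselect (exists t, [/\ A t, (sval t).1 u & (sval t).1 v]); last first.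
      by exists u => t At tu tv; case: nt; exists t.
    exists ((sval t).2 u v) => s As su sv.
    by have [r Ar [/RP[_ ->]// /RP[_ ->]]] := ubound _ _ At As.
  pose S := \bigcup_(t in A) (sval t).1.
  have S2 u v : S u -> S v -> exists2 t, A t & (sval t).1 u /\ (sval t).1 v.
    move=> [s As su] [t At tv].
    have [r Ar [/RP[sr _] /RP[tr _]]] := ubound _ _ As At.
    by exists r => //; split; [exact: sr|exact: tr].
  have goodS : good (S, fun u v => g (u, v)).
    split=> /= [u v Su Sv|u v u' v' Su Sv Su' Sv'|].
    - have [t At [tu tv]] := S2 _ _ Su Sv.
      by exists t => //; rewrite (gP (u, v) t)//; have [+ _ _] := svalP t; apply.
    - have [s As [su sv]] := S2 _ _ Su Sv.
      have [t At [tu tv]] := S2 _ _ Su' Sv'.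
      have [r Ar [/RP[sr _] /RP[tr _]]] := ubound _ _ As At.
      rewrite (gP (u, v) r) ?(gP (u', v') r)//=; first last.
      + exact: sr.
      + exact: sr.
      + exact: tr.
      + exact: tr.
      have [_ + _] := svalP r; apply; by [exact: sr|exact: tr].
    - have [_ _ [a [b [t1a t1b ab]]]] := svalP t1.
      by exists a, b; split=> //; exists t1.
  exists (exist _ _ goodS) => s As; apply/asboolP; split=> /= [u su|u v su sv].
    by exists s.
  by rewrite (gP (u, v) s).
have tmax' g' (S' : set K) : (forall u v, S u -> S v -> g u v = g' u v) ->
    S `<=` S' -> good (S', g') -> S' `<=` S.
  move=> gg' SS' good'.
  by have /asboolP[] := tmax (exist _ _ good') (asboolT (conj SS' gg')).
clear tmax.
have [/pcard_leP/injfunPex[phi phiS phii]|/pcard_leP/injfunPex[phi phiS phii]] :=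
    card_le_total (~` S) S.
  have [//|h hS hi] := pairing_setU_inj gS ginj Sa Sb ab _ phii.
  rewrite setUv in hS hi.
  exists (fun w => g (h w.1) (h w.2)) => -[u v] [u' v'] /=.
  have hinj w w' : h w = h w' -> w = w' by apply: hi; rewrite inE.
  by case/ginj => [||||/hinj-> /hinj-> //]; exact: hS.
have SE u : S u -> ~ (phi @` S) u by move=> Su [v /phiS + e]; rewrite e.
have phiK : {in S, cancel phi (pinv S phi)} by move=> u; exact: pinvKV.
have [||h hS hi] := @pairing_setU_inj _ S (phi @` S) _ (pinv S phi) _ _ gS ginj Sa Sb ab.
- by move=> _ [u Su <-]; rewrite phiK// inE.
- move=> _ _ /set_mem[u Su <-] /set_mem[v Sv <-].
  by rewrite !phiK ?inE// => ->.
pose g' u v := if pselect (S u /\ S v) then g u v else phi (g (h u) (h v)).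
have g'E u v : [/\ S u, S v & g' u v = g u v] \/ g' u v = phi (g (h u) (h v)).
  by rewrite /g'; case: pselect => [[]|]; [left|right].
have hgS w w' : (S `|` phi @` S) w -> (S `|` phi @` S) w' -> S (g (h w) (h w')).
  by move=> Tw Tw'; apply: (gS); exact: hS.
have hinj w w' : (S `|` phi @` S) w -> (S `|` phi @` S) w' -> h w = h w' -> w = w'.
  by move=> Tw Tw'; apply: hi; rewrite inE.
have S'S : S `|` phi @` S `<=` S.
  apply: (tmax' g'); first by rewrite /g' => u v Su Sv; case: pselect => // -[].
    by move=> u; left.
  split=> /= [u v Tu Tv|u v u' v' Tu Tv Tu' Tv'|].
  - case: (g'E u v) => [[Su Sv ->]|->]; first by left; exact: gS.
    by right; exists (g (h u) (h v)) => //; exact: hgS.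
  - case: (g'E u v) (g'E u' v') => [[Su Sv ->]|->] [[Su' Sv' ->]|->].
    + exact: ginj.
    + move=> e; case: (SE (g u v)); first exact: gS.
      by rewrite e; exists (g (h u') (h v')) => //; exact: hgS.
    + move=> e; case: (SE (g u' v')); first exact: gS.
      by rewrite -e; exists (g (h u) (h v)) => //; exact: hgS.
    + move=> /phii; rewrite !inE => /(_ (hgS _ _ Tu Tv) (hgS _ _ Tu' Tv')).
      case/ginj => [||||/hinj eu /hinj ev]; try exact: hS.
      by split; [exact: eu|exact: ev].
  - by exists a, b; split=> //; left.
by case: (SE (phi a)); [apply: S'S; right; exists a|exists a].
Qed.

(** * Limits along ultrafilters, and closure properties of [M] *)

Section ultrafilters.
Context {K : Type}.
Implicit Types (p q : beta K) (R S : set K).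

Instance ultra_filter p : UltraFilter (ultra p) := ultra_ultrafilter p.

Lemma ultra_setC p R : ~ ultra p R -> ultra p (~` R).
Proof. by have [//|] := in_ultra_setVsetC R (ultra_ultrafilter p). Qed.

Lemma ultra_inj p q : ultra p = ultra q -> p = q.
Proof.
by case: p q => [u pu] [v qv] /= uv; rewrite uv in pu *; congr Beta.
Qed.

Lemma proper_setVsetC_ultra (F : set_system K) : ProperFilter F ->
  (forall R, F R \/ F (~` R)) -> UltraFilter F.
Proof.
move=> FF FC; split=> // G GG FG; apply/seteqP; split=> // R GR.
have [//|/FG GnR] := FC R.
exfalso; apply: (@filter_not_empty _ G _).
by rewrite -(setICr R); exact: filterI.
Qed.

(** The sum of the ultrafilters [p_ k] along [p]. By [ulim_betaP] it is the only limit of [p_] along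
    [p] in [beta K]. *)
Definition beta_lim_system p (p_ : K -> beta K) : set_system K :=
  [set R | ultra p [set k | ultra (p_ k) R]].

Lemma beta_lim_ultra p (p_ : K -> beta K) : UltraFilter (beta_lim_system p p_).
Proof.
have FF : ProperFilter (beta_lim_system p p_).
  apply: Build_ProperFilter_ex.
    by move=> R /(@filter_ex _ (ultra p) _)[k /(@filter_ex _ (ultra (p_ k)) _)].
  split=> [|R S pR pS|R S RS pR].
  - by apply: (@filterS _ (ultra p) _ setT) => [k _|]; exact: filterT.
  - apply: (@filterS _ (ultra p)) (filterI (F := ultra p) pR pS) => k [kR kS].
    exact: (filterI (F := ultra (p_ k)) kR kS).
  - by apply: (@filterS _ (ultra p)) pR => k; exact: (@filterS _ (ultra (p_ k))).
apply: (proper_setVsetC_ultra FF) => R.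
have [pR|/ultra_setC pR] := pselect (ultra p [set k | ultra (p_ k) R]).
  by left.
by right; apply: filterS pR => k /=; exact: ultra_setC.
Qed.

Definition beta_lim p (p_ : K -> beta K) : beta K := Beta (beta_lim_ultra p p_).

Lemma beta_map_ultra (h : K -> K) p : UltraFilter (h @ ultra p).
Proof.
apply: proper_setVsetC_ultra => R.
exact: (in_ultra_setVsetC (h @^-1` R) (ultra_ultrafilter p)).
Qed.

Definition beta_map (h : K -> K) p : beta K := Beta (beta_map_ultra h p).

Lemma ulimP (Z : topologicalType) p (x : K -> Z) (z : Z) :
  ulim p x z <-> forall U, open U -> U z -> ultra p (x @^-1` U).
Proof.
split=> [xz U oU Uz|xz U]; first exact/xz/open_nbhs_nbhs.
rewrite nbhsE => -[V [oV Vz] VU].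
by apply: (@filterS _ (ultra p)) (xz _ oV Vz) => k; exact: VU.
Qed.

Lemma ulim_map (Z : topologicalType) (h : K -> K) p (x : K -> Z) :
  ulim (beta_map h p) x = ulim p (x \o h).
Proof. by []. Qed.

Lemma ulim_unique (Z : topologicalType) p (x : K -> Z) :
  hausdorff_space Z -> is_subset1 (ulim p x).
Proof. by move=> hZ y z; exact: cvg_unique. Qed.

Lemma ulim_continuous (Z Y : topologicalType) p (x : K -> Z) (f : Z -> Y) z :
  {for z, continuous f} -> ulim p x z -> ulim p (f \o x) (f z).
Proof. by move=> fz xz; exact: cvg_comp xz fz. Qed.

Lemma ulim_point (Z : topologicalType) k (x : K -> Z) :
  ulim (beta_point k) x (x k).
Proof. by move=> U /nbhs_singleton Ux; exact/principal_filterP. Qed.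

Lemma open_beta_base R : open (beta_base R).
Proof. by exists [set R] => //; rewrite bigcup_set1. Qed.

Lemma ulim_betaP p (p_ : K -> beta K) q :
  ulim p p_ q <-> q = beta_lim p p_.
Proof.
split=> [pq|->]; last first.
  apply/ulimP => U [D _ <-] [R DR pR]; apply: (@filterS _ (ultra p)) pR => k kR.
  by exists R.
apply/ultra_inj/esym.
apply: (@max_filter _ _ (ultra_filter q) _ (@ultra_proper _ _ (beta_lim_ultra p p_))).
by move=> R qR; exact: ((ulimP _ _ _).1 pq _ (open_beta_base R) qR).
Qed.

Lemma beta_N_compact (N : set (beta K)) : N_compact N (beta K).
Proof. by move=> p x _; exists (beta_lim p x); exact/ulim_betaP. Qed.

(** An open [U] around [w] contains [z k] for [p]-almost all [k], and for each such [k] it contains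
    [x l] for [p_ k]-almost all [l]. *)
Lemma ulim_beta_lim (Z : topologicalType) p (p_ : K -> beta K) (x : K -> Z)
    (z : K -> Z) (w : Z) :
  (forall k, ulim (p_ k) x (z k)) -> ulim p z w -> ulim (beta_lim p p_) x w.
Proof.
move=> xz /ulimP zw; apply/ulimP => U oU Uw.
apply: (@filterS _ (ultra p)) (zw U oU Uw) => k zU; exact: ((ulimP _ _ _).1 (xz k)).
Qed.

Section closure.
Context (M : set (beta K)).

Lemma beta_closure_point k : beta_closure M (beta_point k).
Proof. by apply: (sub_smallest (@subset_refl _ _)); exists k. Qed.

(** Induction over [M]: a set of ultrafilters is [M]-closed as soon as it is stable under [beta_lim]
    along members of [M]. *)
Lemma beta_closure_ind (P : set (beta K)) :
  (forall k, P (beta_point k)) ->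
  (forall q (p_ : K -> beta K), M q -> (forall k, P (p_ k)) -> P (beta_lim q p_)) ->
  beta_closure M `<=` P.
Proof.
move=> Ppt Plim p /(_ P); apply; split; last by move=> _ [k _ <-].
by move=> p_ q Pp Mq r /ulim_betaP->; exact: Plim.
Qed.

(** By induction on [p]: for a principal [p] a value of [x] is a limit; for a sum, limits in [A]
    along the [p_ k] are chosen, and a limit of these along [q] exists by [M]-compactness and stays
    in [A]. With [A] the whole space this yields [M]-compactness; with [A] = [M] it yields stability
    of [M] under sums. *)
Lemma beta_closure_ulim (Z : topologicalType) (A : set Z) p (x : K -> Z) :
  N_compact M Z -> N_closed M A -> (forall k, A (x k)) -> beta_closure M p ->
  ulim p x `&` A !=set0.
Proof.
move=> ZM AM Ax; move: p; apply: beta_closure_ind => [k|q p_ Mq].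
  by exists (x k); split=> //; exact: ulim_point.
move=> /choice[z zP]; have [w zw] := ZM q z Mq; exists w; split.
  by apply: ulim_beta_lim zw => k; exact: (zP k).1.
by apply: AM zw => // k; exact: (zP k).2.
Qed.

Lemma beta_closure_compact (Z : topologicalType) :
  N_compact M Z -> N_compact (beta_closure M) Z.
Proof.
move=> ZM p x /(@beta_closure_ulim Z setT _ x ZM).
by case=> // z [xz _]; exists z.
Qed.

Lemma beta_closure_lim p (p_ : K -> beta K) :
  beta_closure M p -> (forall k, beta_closure M (p_ k)) ->
  beta_closure M (beta_lim p p_).
Proof.
move=> Mp Mp_.
have [_ [/ulim_betaP-> //]] :=
  beta_closure_ulim (@beta_N_compact M) (@N_closure_closed _ M _ _) Mp_ Mp.
Qed.

(** The image under [h] of a principal ultrafilter is principal, and taking images commutes with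
    [beta_lim]. *)
Lemma beta_closure_map (h : K -> K) p :
  beta_closure M p -> beta_closure M (beta_map h p).
Proof.
move: p; apply: (@beta_closure_ind [set p | beta_closure M (beta_map h p)]) => /=.
  move=> k; suff -> : beta_map h (beta_point k) = beta_point (h k).
    exact: beta_closure_point.
  apply: ultra_inj; apply/seteqP; split=> R /=.
    by move/principal_filterP => ?; exact/principal_filterP.
  by move/principal_filterP => ?; exact/principal_filterP.
move=> q p_ Mq Mp_.
have -> : beta_map h (beta_lim q p_) = beta_lim q (beta_map h \o p_).
  exact: ultra_inj.
apply: (N_closure_closed Mp_ Mq); exact/ulim_betaP.
Qed.

(* The witness is the image under an injection [K * K -> K] of the ultrafilter
   of all R such that, for p-almost all k, (k, l) is in R for (p_ k)-almost all l. *)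
Lemma beta_closure_iterated_lim (p : beta K) (p_ : K -> beta K) (T : Type)
    (x_ : K -> K -> T) :
  infinite_set [set: K] ->
  beta_closure M p -> (forall k, beta_closure M (p_ k)) ->
  exists2 q, beta_closure M q & exists x : K -> T,
    forall (Z : topologicalType) (e : T -> Z) (z : K -> Z) (w : Z),
      (forall k, ulim (p_ k) (e \o x_ k) (z k)) -> ulim p z w ->
      ulim q (e \o x) w.
Proof.
move=> infK Mp Mp_; have [g gi] := infinite_prod_inj infK.
have [k0 _] := infinite_setN0 infK.
have [d gd] := injective_cancel (k0, k0) gi.
exists (beta_lim p (fun k => beta_map (fun l => g (k, l)) (p_ k))).
  by apply: beta_closure_lim => // k; exact: beta_closure_map.
exists (fun k => x_ (d k).1 (d k).2) => Z e z w xz; apply: ulim_beta_lim => k.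
rewrite ulim_map.
suff -> : e \o (fun k => x_ (d k).1 (d k).2) \o (fun l => g (k, l)) = e \o x_ k.
  exact: xz.
by apply/funext => l /=; rewrite gd.
Qed.

End closure.
End ultrafilters.

(** * Coincidence sets of [N]-continuous maps, and limits in subspaces *)

Lemma N_continuous_eq (K : Type) (N : set (beta K)) (Z Y : topologicalType)
    (f g : Z -> Y) :
  hausdorff_space Y -> N_continuous N f -> N_continuous N g ->
  N_closed N [set z | f z = g z].
Proof.
move=> hY fN gN x p fg Np z xz; apply: (@ulim_unique _ _ p (f \o x) hY).
  by apply: (fN p x Np); exists z.
rewrite (_ : f \o x = g \o x); last exact/funext.
by apply: (gN p x Np); exists z.
Qed.

Lemma ulim_set_val (K : Type) (Z : topologicalType) (A : set Z) (p : beta K)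
    (x : K -> A) (z : A) :
  ulim p x z <-> ulim p (\val \o x) (\val z).
Proof.
split=> [|xz]; first by apply: ulim_continuous; exact: initial_continuous.
apply/ulimP => _ [V oV <-] Vz.
exact: ((ulimP _ _ _).1 xz).
Qed.

(** * Limits of points of [X] in the Wallman extension *)

Section wallman_limits.
Context {X : topologicalType}.
Implicit Type w : wallman X.

Lemma cultraT w : cultra w setT.
Proof.
have [[A wA]|w0] := pselect (cultra w !=set0); last first.
  apply: (cultra_max (cultraP w)); first exact: closedT.
  by move=> A wA; case: w0; exists A.
apply: (cultra_max (cultraP w)); first exact: closedT.
move=> B wB; rewrite setTI; apply/set0P/eqP => B0.
by apply: (cultra_set0 (cultraP w)); rewrite -B0.
Qed.

Lemma wallman_inj w w' : cultra w `<=` cultra w' -> w = w'.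
Proof.
move=> ww'; have {}ww' : cultra w = cultra w'.
  apply/seteqP; split=> // A w'A; apply: (cultra_max (cultraP w)).
    exact: cultra_closed (cultraP w') _ w'A.
  move=> B /ww' w'B; apply/set0P/eqP => AB0.
  apply: (cultra_set0 (cultraP w')); rewrite -AB0.
  exact: cultra_setI (cultraP w') _ _ w'A w'B.
by case: w w' ww' => [w wP] [w' w'P] /= e; rewrite e in wP *; congr Wallman.
Qed.

Lemma open_wallman_base (U : set X) : open U -> open (wallman_base U).
Proof. by move=> oU; exists [set U]; [move=> _ ->|rewrite bigcup_set1]. Qed.

Context (T1 : @accessible_space X).

Lemma wallman_base_point (U : set X) x : wallman_base U (wallman_point T1 x) <-> U x.
Proof.
split=> [[A [_ Ax] AU]|Ux]; first exact: AU.
exists [set x]; last by move=> _ ->.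
by split=> //; exact: accessible_closed_set1.
Qed.

(** The trace of [wallman_base U] on [X] is [U], so convergence can be tested on open subsets of
    [X]. *)
Lemma ulim_wallman_pointP (K : Type) (p : beta K) (x : K -> X) w :
  ulim p (wallman_point T1 \o x) w <->
  forall U, open U -> wallman_base U w -> ultra p (x @^-1` U).
Proof.
have ? := ultra_ultrafilter p.
split=> [xw U oU Uw|xw].
  have := (ulimP _ _ _).1 xw _ (open_wallman_base oU) Uw.
  by apply: filterS => k /wallman_base_point.
apply/ulimP => _ [D Do <-] [U DU Uw]; apply: filterS (xw U (Do _ DU) Uw) => k Uk.
by exists U => //; exact/wallman_base_point.
Qed.

(** If [closure A] missed a member of [w], its complement would give a neighbourhood of [w], and [x]
    would be [p]-almost always outside [closure A]. *)
Lemma ulim_wallman_closure (K : Type) (p : beta K) (x : K -> X) w (A : set X) :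
  ulim p (wallman_point T1 \o x) w -> ultra p (x @^-1` A) ->
  cultra w (closure A).
Proof.
have ? := ultra_ultrafilter p.
move=> /ulim_wallman_pointP xw pA; apply: (cultra_max (cultraP w)).
  exact: closed_closure.
move=> B wB; apply: contrapT => AB0.
have /(filterI pA)/filter_ex[k [Ak nAk]] : ultra p (x @^-1` ~` closure A).
  apply: xw; first exact/closed_openC/closed_closure.
  by exists B => // y By Ay; apply: AB0; exists y.
by apply: nAk; exact: subset_closure.
Qed.

(** The members of [w] generate a filter, which clusters at some [x] in [C]. Being closed, they all
    contain [x], and maximality of [w] does the rest. *)
Lemma wallman_compact w (C : set X) :
  cultra w C -> compact C -> exists x, w = wallman_point T1 x.
Proof.
move=> wC cC; pose F := filter_from (cultra w) id.
have FF : ProperFilter F.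
  apply: filter_from_proper; last first.
    move=> A wA; apply/set0P/eqP => A0.
    by apply: (cultra_set0 (cultraP w)); rewrite -A0.
  apply: filter_from_filter; first by exists setT; exact: cultraT.
  by move=> A B wA wB; exists (A `&` B) => //; exact: cultra_setI (cultraP w) _ _ wA wB.
have [|x [Cx Fx]] := cC F FF; first by exists C.
exists x; apply: wallman_inj => A wA.
have cA := cultra_closed (cultraP w) wA; split=> //.
by rewrite ((closure_id _).1 cA); move: Fx; rewrite clusterE; apply; exists A.
Qed.

End wallman_limits.

(** * The graph of the extension: closure under limits, totality, single-valuedness *)

Section extension.
Context (K : Type) (infK : infinite_set [set: K]) (M : set (beta K))
  (X Y : topologicalType) (T1 : @accessible_space X) (hY : hausdorff_space Y)
  (YM : N_compact M Y) (f : X -> Y) (cf : continuous f).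

Local Notation j := (wallman_point T1).

(** A relation, so that existence and uniqueness of the value can be treated apart. Both limits
    share the same [p] and [x]. *)
Definition extension_graph (w : wallman X) (y : Y) :=
  exists p x, [/\ beta_closure M p, ulim p (j \o x) w & ulim p (f \o x) y].

Lemma extension_graph_point x : extension_graph (j x) (f x).
Proof.
have [k _] := infinite_setN0 infK.
exists (beta_point k), (fun=> x); split.
- exact: beta_closure_point.
- exact: ulim_point k (j \o (fun=> x)).
- exact: ulim_point k (f \o (fun=> x)).
Qed.

(** [beta_closure_iterated_lim] produces [q] and [x] before the map [e], so the same pair serves for
    [e] = [j] and for [e] = [f]. The result gives both totality and [M]-continuity. *)
Lemma extension_graph_lim p (z : K -> wallman X) (y : K -> Y) w v :
  beta_closure M p -> (forall k, extension_graph (z k) (y k)) ->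
  ulim p z w -> ulim p y v -> extension_graph w v.
Proof.
move=> Mp /choice[p_ /choice[x_ zy]] zw yv.
have [||q Mq [x xP]] := @beta_closure_iterated_lim _ M p p_ _ x_ infK.
- by [].
- by move=> k; have [] := zy k.
exists q, x; split=> //.
  by apply: xP zw => k; have [] := zy k.
by apply: xP yv => k; have [] := zy k.
Qed.

(** The domain of the graph contains the image of [j] and is [M]-closed, because values chosen along
    a sequence have a limit in [Y]. *)
Lemma extension_graph_total w :
  wallmanM M T1 w -> exists y, extension_graph w y.
Proof.
move/(_ [set w | exists y, extension_graph w y]); apply; split.
  move=> z p /choice[y zy] Mp w' zw.
  have [v yv] := beta_closure_compact YM y Mp.
  by exists v; exact: extension_graph_lim zw yv.
by move=> _ [x _ <-]; exists (f x); exact: extension_graph_point.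
Qed.

Lemma extension_graph_unique w y y' :
  kbar_urysohn K Y \/ (forall U V : set X, ~ long_butterfly K U V) ->
  extension_graph w y -> extension_graph w y' -> y = y'.
Proof.
move=> hXY [p [x [Mp xw xy]]] [p' [x' [Mp' x'w x'y']]].
apply: contrapT => yy'.
have fibre (V : set Y) q (u : K -> X) v : ulim q (j \o u) w ->
    ulim q (f \o u) v -> open V -> V v ->
    cultra w (closure (range u `&` f @^-1` V)).
  move=> uw uv oV Vv; apply: (ulim_wallman_closure uw).
  have ? := ultra_ultrafilter q.
  apply: filterS ((ulimP _ _ _).1 uv V oV Vv) => k Vk.
  by split=> //; exists k.
have fibreI V V' : open V -> open V' -> V y -> V' y' ->
    cultra w (closure (range x `&` f @^-1` V) `&` closure (range x' `&` f @^-1` V')).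
  move=> oV oV' Vy V'y'.
  by apply: (cultra_setI (cultraP w)); [exact: fibre xw xy _ _|exact: fibre x'w x'y' _ _].
have cultra_ex A : cultra w A -> A !=set0.
  move=> wA; apply/set0P/eqP => A0.
  by apply: (cultra_set0 (cultraP w)); rewrite -A0.
case: hXY => [urysohnY|noflyX].
  (* Two families indexed by [K] merge into one: [d] decodes an index into a pair, whose second
     entry selects [x] if it is [a], and [x'] otherwise. *)
  have leK : f @` (range x `|` range x') #<= [set: K].
    have [g gi] := infinite_prod_inj infK.
    have [a _] := infinite_setN0 infK.
    have [b ba] : exists b, b <> a.
      apply: contrapT => nb; apply: infK.
      suff -> : [set: K] = [set a] by exact: finite_set1.
      by apply/seteqP; split=> // b _; apply: contrapT => ba; apply: nb; exists b.
    have [d gd] := injective_cancel (a, a) gi.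
    pose h k := f (if pselect ((d k).2 = a) then x (d k).1 else x' (d k).1).
    apply: card_le_trans (card_image_le h _); apply: subset_card_le.
    move=> _ [_ [[k _ <-]|[k _ <-]] <-].
      by exists (g (k, a)) => //; rewrite /h gd; case: pselect.
    by exists (g (k, b)) => //; rewrite /h gd; case: pselect => // /ba.
  (* The Urysohn property is used with [C] the image under [f] of both ranges. By continuity [f z]
     then lies in both of the closures that should be disjoint. *)
  have [V [V' [[oV oV' _ Vy V'y'] VV'0]]] := urysohnY _ _ _ leK yy'.
  have [z [Vz V'z]] := cultra_ex _ (fibreI _ _ oV oV' Vy V'y').
  suff : set0 (f z) by [].
  have closure_image A B : f @` A `<=` B -> closure A z -> closure B (f z).
    move=> AB Az U /cf /Az[t [At Ut]]; exists (f t); split=> //.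
    by apply: AB; exists t.
  rewrite -VV'0; split.
    apply: closure_image Vz => _ [t [xt Vt] <-]; split=> //.
    by exists t => //; left.
  apply: closure_image V'z => _ [t [xt Vt] <-]; split=> //.
  by exists t => //; right.
have /eqP := yy'; move: hY; rewrite open_hausdorff => /[apply].
move=> [[V V'] /= [/set_mem Vy /set_mem V'y'] [oV oV' /eqP VV'0]].
have wI := fibreI _ _ oV oV' Vy V'y'.
have cI : compact (closure (range x `&` f @^-1` V) `&`
                   closure (range x' `&` f @^-1` V')).
  apply: contrapT => ncI.
  have lerange (u : K -> X) U : range u `&` U #<= [set: K].
    exact: card_le_trans (subset_card_le (@subIsetl _ _ _)) (card_image_le _ _).
  apply: (noflyX (f @^-1` V) (f @^-1` V')); split.
    split; [exact: open_comp|exact: open_comp| |].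
      by rewrite -preimage_setI VV'0 preimage_set0.
    have [z [Vz V'z]] := cultra_ex _ wI; exists z.
    by split; [apply: closureS Vz|apply: closureS V'z] => t [].
  (* The small subsets of the two wings are their traces on the ranges of [x] and [x']. *)
  exists (range x `&` f @^-1` V), (range x' `&` f @^-1` V'); split.
    by split=> //; try exact: subIsetr.
  by split=> //; exact: cultra_ex.
have [x0 wx0] := wallman_compact T1 wI cI.
have lim_fx0 q (u : K -> X) : ulim q (j \o u) w -> ulim q (f \o u) (f x0).
  rewrite wx0 => /ulim_wallman_pointP ux0; apply: ulim_continuous; first exact: cf.
  by apply/ulimP => U oU Ux0; apply: ux0 => //; exact/wallman_base_point.
by apply: yy'; rewrite (ulim_unique hY xy (lim_fx0 _ _ xw));
  exact: ulim_unique (lim_fx0 _ _ x'w) x'y'.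
Qed.

End extension.

(** * Construction of the extension, and its uniqueness *)

Theorem theorem8p4 (K : Type) (hK : infinite_set [set: K])
    (M : set (beta K)) (hM : M !=set0)
    (X Y : topologicalType) (hX : @accessible_space X)
    (hY : hausdorff_space Y) (hYM : N_compact M Y)
    (hXY : kbar_urysohn K Y \/
           (forall U V : set X, ~ long_butterfly K U V))
    (f : X -> Y) (hf : continuous f) :
  exists! fbar : wallmanM M hX -> Y,
    N_continuous (beta_closure M) fbar /\ f = fbar \o wallmanM_embed M hX.
Proof.
have /choice[fbar fbarP] : forall w : wallmanM M hX,
    exists y, extension_graph M hX f (\val w) y.
  by move=> w; apply: extension_graph_total => //; exact/set_mem/valP.
have graph_unique w y y' : extension_graph M hX f w y ->
    extension_graph M hX f w y' -> y = y' by exact: extension_graph_unique.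
have fbar_cont : N_continuous (beta_closure M) fbar.
  move=> p z Mp _ [w zw <-].
  (* Some limit [v] of [fbar \o z] exists; as the graph is closed under limits and single-valued,
     [v] is [fbar w]. *)
  have [v fv] := beta_closure_compact hYM (fbar \o z) Mp.
  have zw' : ulim p (\val \o z) (\val w) by exact/ulim_set_val.
  by rewrite (graph_unique _ _ _ (fbarP w)
    (extension_graph_lim hK Mp (fun k => fbarP (z k)) zw' fv)).
have fbar_ext : f = fbar \o wallmanM_embed M hX.
  apply/funext => x.
  apply: (graph_unique (wallman_point hX x)); first exact: extension_graph_point.
  exact: (fbarP (wallmanM_embed M hX x)).
exists fbar; split=> // g [gc gf]; apply/funext => w.
(* The coincidence set of [fbar] and [g] is moved into [wallman X], where [wallmanM] is the smallest
   [M]-closed set containing the image of [X]. *)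
pose E : set (wallman X) := \val @` [set v : wallmanM M hX | fbar v = g v].
have EN : N_closed (beta_closure M) E.
  move=> x p Ex Mp v xv.
  have /choice[z zP] k : exists z : wallmanM M hX, fbar z = g z /\ \val z = x k.
    by have [z ? ?] := Ex k; exists z.
  have Wv : v \in wallmanM M hX.
    apply/mem_set; apply: (N_closure_closed _ Mp xv) => k.
    by have [_ <-] := zP k; exact/set_mem/valP.
  exists (exist _ v Wv) => //.
  apply: (N_continuous_eq hY fbar_cont gc (x := z) _ Mp) => [k|].
    by have [] := zP k.
  apply/ulim_set_val; rewrite (_ : \val \o z = x) //.
  by apply/funext => k; have [] := zP k.
have Ej : range (wallman_point hX) `<=` E.
  move=> _ [x _ <-]; exists (wallmanM_embed M hX x) => //=.
  by have := congr1 (fun h => h x) (etrans (esym fbar_ext) gf).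
by have [v fgv /val_inj<-] := set_mem (valP w) E (conj EN Ej).
Qed.
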